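(* Let $G$ be a connected graph with $k$ pendant edges. If $l$ ($l\leq k$) pendant edges are removed from $G$ (keeping all vertices), yielding the graph $G'$, then $$meg(G)-l\leq meg(G')\leq meg(G).$$ Moreover, both the lower and the upper bounds are tight (i.e. for each of the two inequalities there are graphs $G$ and choices of removed pendant edges for which equality holds).
   Context: Graphs are finite, undirected and simple. A cut edge is an edge whose removal increases the number of connected components; a pendant edge is a cut edge with one of its end vertices of degree one. In a connected graph $H$, an edge $e$ is monitored by a pair of vertices $x,y$ if $e$ lies on all shortest paths between $x$ and $y$. A set $M\subseteq V(H)$ is a monitoring edge-geodetic set (MEG-set) of $H$ if every edge of $H$ is monitored by some pair of vertices of $M$; $meg(H)$ is the minimum size of a MEG-set of $H$. For a disconnected graph, a MEG-set is the union of MEG-sets of its connected components, where the MEG-set of an isolated vertex is taken to be empty; so $meg$ is the sum of the $meg$ of the components, an isolated vertex contributing $0$.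
   Formalization: A pendant edge is required to have exactly one end vertex of degree one, which excludes only the edge of K_2; removing that edge would violate the lower bound, since meg(K_2)=2 while two isolated vertices have meg 0. *)

(* Defs.v *)
From mathcomp Require Import all_boot.

Set Implicit Arguments.
Unset Strict Implicit.
Unset Printing Implicit Defensive.

Record sgraph := SGraph {
  vertex :> finType;
  adj : rel vertex;
  adj_sym : symmetric adj;
  adj_irr : irreflexive adj
}.

(* Edges are two-element vertex sets. *)
Definition edges (G : sgraph) : {set {set G}} :=
  [set E | [exists x : G, exists y : G, adj x y && (E == [set x; y])]].

Definition degree (G : sgraph) (x : G) : nat := #|[set y | adj x y]|.

Definition ncomp (G : sgraph) : nat := n_comp (@adj G) G.

(* In particular a connected graph has at least one vertex. *)
Definition connected (G : sgraph) : bool := ncomp G == 1.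

Definition components (G : sgraph) : {set {set G}} :=
  equivalence_partition (connect (@adj G)) [set: G].

Section DeleteEdges.
Variables (G : sgraph) (F : {set {set G}}).

Definition del_adj : rel G := [rel x y | adj x y && ([set x; y] \notin F)].

Lemma del_adj_sym : symmetric del_adj.
Proof. by move=> x y; rewrite /del_adj /= adj_sym setUC. Qed.

Lemma del_adj_irr : irreflexive del_adj.
Proof. by move=> x; rewrite /del_adj /= adj_irr. Qed.

Definition del_edges : sgraph := SGraph del_adj_sym del_adj_irr.

End DeleteEdges.

Section Induced.
Variables (G : sgraph) (C : {set G}).

Definition induced_adj : rel {x : G | x \in C} :=
  [rel x y | adj (val x) (val y)].

Lemma induced_adj_sym : symmetric induced_adj.
Proof. by move=> x y; rewrite /induced_adj /= adj_sym. Qed.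

Lemma induced_adj_irr : irreflexive induced_adj.
Proof. by move=> x; rewrite /induced_adj /= adj_irr. Qed.

Definition induced : sgraph := SGraph induced_adj_sym induced_adj_irr.

End Induced.

Definition cut_edge (G : sgraph) (E : {set G}) : bool :=
  (E \in edges G) && (ncomp G < ncomp (del_edges [set E])).

(* "One of its end vertices has degree one" is read as exactly one. In a
   connected graph this differs from "at least one" only for the edge of K_2,
   where the lower bound on meg fails: meg K_2 = 2, but removing the edge leaves
   two isolated vertices, with meg 0. *)
Definition pendant_edges (G : sgraph) : {set {set G}} :=
  [set E | cut_edge E && (#|[set x in E | degree x == 1]| == 1)].

Definition is_walk (G : sgraph) (x y : G) (p : seq G) : bool :=
  path (@adj G) x p && (last x p == y).

(* A shortest path has fewer than #|G| edges, so it is enough to search below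
   #|G|; the value is #|G| when y is not reachable from x. *)
Definition dist (G : sgraph) (x y : G) : nat :=
  find (fun n => [exists p : n.-tuple G, is_walk x y p]) (iota 0 #|G|).

Definition walk_edges (G : sgraph) (x : G) (p : seq G) : seq {set G} :=
  [seq [set z.1; z.2] | z <- zip (x :: p) p].

(* The vertices of a walk of length dist x y are automatically distinct, so
   p ranges over the shortest paths from x to y. *)
Definition monitored (G : sgraph) (E : {set G}) (x y : G) : bool :=
  [forall p : (dist x y).-tuple G, is_walk x y p ==> (E \in walk_edges x p)].

(* Only meaningful for connected H: between vertices of different components
   [monitored] holds vacuously. *)
Definition meg_set (H : sgraph) (M : {set H}) : bool :=
  [forall E in edges H, exists x in M, exists y in M, monitored E x y].

(* The default value #|H| is harmless: [set: H] is a MEG-set. *)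
Definition meg_conn (H : sgraph) : nat :=
  \big[minn/#|H|]_(M : {set H} | meg_set M) #|M|.

(* A component that is an isolated vertex contributes 0, since it has no edge
   and hence set0 is a MEG-set of it. *)
Definition meg (G : sgraph) : nat :=
  if connected G then meg_conn G
  else \sum_(C in components G) meg_conn (induced C).

(* Main.v *)
(* Let [H] be the only component of [G - F] that can have an edge, i.e. [G]
   without the leaves of [F]. Moving every such leaf to its neighbour turns a
   MEG-set of [G] into one of [H]. Conversely a MEG-set of [H] together with
   the removed leaves is a MEG-set of [G]: geodesics of [G] between vertices of
   [H] stay in [H], and a pendant edge is monitored by its leaf and any other
   vertex. Such a vertex exists since the other end of a pendant edge has
   degree at least 2: if the MEG-set of [H] is empty, then [G] is a star with
   several leaves.
   The path on three vertices attains the lower bound when both edges are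
   removed and the upper bound when one is. *)

Require Import Defs.
From mathcomp Require Import all_boot.

Set Implicit Arguments.
Unset Strict Implicit.
Unset Printing Implicit Defensive.

Section Graph.
Variable G : sgraph.
Implicit Types (x y : G) (p q : seq G) (E : {set G}) (M : {set G}).

Lemma edgesP E :
  reflect (exists x, exists2 y, adj x y & E = [set x; y]) (E \in edges G).
Proof.
rewrite inE; apply: (iffP existsP) => [[x /existsP[y /andP[xy /eqP]]]|].
  by exists x, y.
by case=> x [y xy ->]; exists x; apply/existsP; exists y; rewrite xy eqxx.
Qed.

Lemma mem_edges x y : adj x y -> [set x; y] \in edges G.
Proof. by move=> xy; apply/edgesP; exists x, y. Qed.

Lemma connect_adjC : connect_sym (@adj G).
Proof. exact/sym_connect_sym/adj_sym. Qed.

Lemma connectedP :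
  reflect ((exists x : G, true) /\ forall x y, connect (@adj G) x y)
          (connected G).
Proof.
rewrite /connected /ncomp; apply: (iffP idP) => [/eqP n1|[[x _] conn]].
  split.
    move: n1; case: (pickP G) => [x _|G0]; first by exists x.
    by rewrite /n_comp_mem eq_card0 // => x; have := G0 x.
  move=> x y; rewrite -(root_connect connect_adjC).
  have := eq_leq n1; rewrite /n_comp_mem => /card_le1_eqP le1.
  by apply/eqP/le1; rewrite inE /= (roots_root connect_adjC).
rewrite -(n_comp_connect connect_adjC x); apply/eqP.
by apply: eq_n_comp_r => y; rewrite !inE conn.
Qed.

Lemma walk_edges_cons x y p :
  walk_edges x (y :: p) = [set x; y] :: walk_edges y p.
Proof. by []. Qed.

Lemma walk_edges_cat x p q :
  walk_edges x (p ++ q) = walk_edges x p ++ walk_edges (last x p) q.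
Proof. by elim: p x => //= y p IH x; rewrite !walk_edges_cons IH. Qed.

Definition geodesic x y p : Prop :=
  is_walk x y p /\ forall q, is_walk x y q -> size p <= size q.

Lemma dist_le x y p : is_walk x y p -> dist x y <= size p.
Proof.
move=> wp; rewrite /dist; have [ltp|gep] := ltnP (size p) #|G|; last first.
  by apply: leq_trans gep; rewrite -[leqRHS](size_iota 0) find_size.
rewrite leqNgt; apply/negP => /(before_find 0).
rewrite nth_iota //= add0n => /negbT/existsPn/(_ (in_tuple p)).
by rewrite wp.
Qed.

Lemma geodesic_dist x y : connect (@adj G) x y ->
  exists2 p, is_walk x y p & size p = dist x y.
Proof.
case/connectP => p0 /shortenP[p pp up _] ->.
set P := fun n => [exists q : n.-tuple G, is_walk x (last x p) q].
have hasP : has P (iota 0 #|G|).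
  apply/hasP; exists (size p); last first.
    by apply/existsP; exists (in_tuple p); rewrite /is_walk pp eqxx.
  rewrite mem_iota /= add0n -[_.+1]/(size (x :: p)) -(card_uniqP up).
  exact: max_card.
have lt_dist : find P (iota 0 #|G|) < #|G|.
  by rewrite -[ltnRHS](size_iota 0) -has_find.
have := nth_find 0 hasP; rewrite nth_iota // add0n.
by case/existsP=> q wq; exists q; rewrite ?size_tuple.
Qed.

Lemma geodesicP x y p :
  geodesic x y p <-> is_walk x y p /\ size p = dist x y.
Proof.
split=> [[wp minp]|[wp szp]]; last by split=> // q; rewrite szp; apply: dist_le.
have /geodesic_dist[q wq szq] : connect (@adj G) x y.
  by case/andP: wp => pp /eqP <-; apply/connectP; exists p.
split=> //; apply/eqP; rewrite eqn_leq dist_le // andbT -szq.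
exact: minp.
Qed.

Lemma monitoredP E x y :
  reflect (forall p, geodesic x y p -> E \in walk_edges x p) (monitored E x y).
Proof.
apply: (iffP forallP) => [mon p /geodesicP[wp szp]|mon p].
  have szp' : size p == dist x y by apply/eqP.
  exact: (implyP (mon (Tuple szp'))).
by apply/implyP => wp; apply/mon/geodesicP; rewrite size_tuple.
Qed.

Lemma monitored_irr E x : ~~ monitored E x x.
Proof.
apply/negP => /monitoredP/(_ [::]) mon.
by have : E \in [::] by apply: mon; split; rewrite // /is_walk /= eqxx.
Qed.

Lemma monitored_adj x y : adj x y -> monitored [set x; y] x y.
Proof.
move=> xy; apply/monitoredP => p [/andP[pp lp]].
move=> /(_ [:: y]); rewrite /is_walk /= xy eqxx => /(_ isT).
case: p pp lp => [|z [|]] //=.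
  by move=> _ /eqP eqxy; rewrite eqxy adj_irr in xy.
by move=> _ /eqP-> _; rewrite inE.
Qed.

Lemma meg_setP M :
  reflect (forall x y, adj x y ->
             exists2 u, u \in M & exists2 v, v \in M & monitored [set x; y] u v)
          (meg_set M).
Proof.
apply: (iffP forall_inP) => [megM x y /mem_edges /megM|megM E].
  by case/exists_inP=> u Mu /exists_inP[v Mv mon]; exists u => //; exists v.
case/edgesP=> x [y xy ->].
have [u Mu [v Mv mon]] := megM _ _ xy.
by apply/exists_inP; exists u => //; apply/exists_inP; exists v.
Qed.

Lemma meg_conn_le M : meg_set M -> meg_conn G <= #|M|.
Proof.
move=> megM; rewrite /meg_conn; have := mem_index_enum M.
elim: index_enum => // N r IH; rewrite big_cons inE => /orP[/eqP <-|/IH le_M].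
  by rewrite megM geq_minl.
by case: ifP => // _; apply: leq_trans le_M; apply: geq_minr.
Qed.

Lemma meg_conn_attained : exists2 M : {set G}, meg_set M & #|M| = meg_conn G.
Proof.
rewrite /meg_conn; elim/big_ind: _ => [|m n|M megM]; last by exists M.
  exists setT; last by rewrite cardsT.
  apply/meg_setP => x y xy; exists x => //; exists y => //.
  exact: monitored_adj.
by rewrite /minn; case: ifP.
Qed.

Lemma meg_conn_edgeless : edges G = set0 -> meg_conn G = 0.
Proof.
move=> noE; apply/eqP; rewrite -leqn0 -(cards0 G); apply: meg_conn_le.
by apply/forall_inP => E; rewrite noE inE.
Qed.

Lemma meg_conn_ge2 x y : adj x y -> 2 <= meg_conn G.
Proof.
move=> xy; have [M /meg_setP megM <-] := meg_conn_attained.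
have [u Mu [v Mv mon]] := megM _ _ xy.
apply/card_gt1P; exists u, v; split=> //.
by apply: contraTneq mon => ->; apply: monitored_irr.
Qed.

End Graph.

(* [G] is [H], embedded by [f], with leaves attached: [s] retracts [G] onto [H]
   and a vertex [v] outside the image of [f] has [f (s v)] as only neighbour. *)
Section PendantExtension.
Variables (H G : sgraph) (f : H -> G) (s : G -> H).
Hypothesis fK : cancel f s.
Hypothesis f_adj : {mono f : x y / adj x y}.

Definition attached : {set G} := [set v | f (s v) != v].

Hypothesis attached_adj :
  forall v u, v \in attached -> adj v u = (u == f (s v)).

Let f_inj : injective f := can_inj fK.

Lemma f_attached x : (f x \in attached) = false.
Proof. by rewrite inE fK eqxx. Qed.

Lemma not_attached v : v \notin attached -> f (s v) = v.
Proof. by rewrite inE negbK => /eqP. Qed.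

Lemma walk_map x y p : is_walk x y p -> is_walk (f x) (f y) (map f p).
Proof.
case/andP=> pp /eqP <-; rewrite /is_walk last_map eqxx andbT path_map.
by rewrite (@eq_path _ _ (@adj H)) // => a b /=; rewrite f_adj.
Qed.

Lemma walk_edges_map x p :
  walk_edges (f x) (map f p) = map (fun E : {set H} => f @: E) (walk_edges x p).
Proof.
elim: p x => //= y p IH x; rewrite !walk_edges_cons /= -IH.
by rewrite imsetU !imset_set1.
Qed.

(* Each end of the walk outside [H] costs one step that the retraction saves;
   the factor [u != v] discards the trivial walk at such a vertex. *)
Lemma walk_retract u v p : is_walk u v p ->
  exists q, [/\ is_walk (s u) (s v) q,
    {subset map (fun E : {set H} => f @: E) (walk_edges (s u) q)
       <= walk_edges u p} &
    size q + (u != v) * ((u \in attached) + (v \in attached)) <= size p].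
Proof.
elim: p u => [|w p IH] u; rewrite /is_walk /=.
  by move/eqP=> ->; exists [::]; rewrite eqxx /is_walk /=.
case/andP=> /andP[uw pp] lp.
have [|q [wq subq szq]] := IH w; first by rewrite /is_walk pp.
have sub E : E \in walk_edges w p -> E \in walk_edges u (w :: p).
  by rewrite walk_edges_cons inE orbC => ->.
have [au|nau] := boolP (u \in attached).
  move: uw; rewrite attached_adj // => /eqP wE.
  exists q; split.
  - by move: wq; rewrite wE fK.
  - by move=> E EQ; apply/sub/subq; rewrite wE fK.
  - move: szq; rewrite {2}wE f_attached add0n.
    case: (w =P v) => [<-|_]; rewrite ?(mul0n, mul1n).
      rewrite wE f_attached.
      case: (_ != _); rewrite ?(addn0, mul1n, mul0n) ?addn1 //.
      by move/leq_trans; apply.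
    case: (_ != _); rewrite ?(addn0, mul1n, mul0n).
      by rewrite addnCA add1n.
    by move=> h; apply: leqW; apply: leq_trans h; apply: leq_addr.
have [aw|naw] := boolP (w \in attached).
  move: uw; rewrite adj_sym attached_adj // => /eqP uE.
  exists q; split.
  - by move: wq; rewrite uE fK.
  - by move=> E EQ; apply/sub/subq; move: EQ; rewrite uE fK.
  - move: szq; rewrite aw.
    case: (w =P v) => [<-|_]; rewrite ?(mul0n, mul1n, addn0).
      by rewrite aw; case: (_ != _); rewrite ?addn0 ?addn1 // => /leqW.
    move=> h; apply: leqW; apply: leq_trans h; rewrite leq_add2l.
    by case: (_ != _); rewrite ?mul1n ?leq_addl.
have [fu fw] := (not_attached nau, not_attached naw).
exists (s w :: q); split.
- by case/andP: wq => pq lq; rewrite /is_walk /= pq lq -f_adj fu fw uw.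
- move=> E; rewrite walk_edges_cons /= !inE imsetU !imset_set1 fu fw.
  by case/orP => [->|/subq ->]; rewrite ?orbT.
- move: szq; rewrite (negPf naw) /= addSn ltnS; apply: leq_trans.
  rewrite leq_add2l add0n; case: (w =P v) => [<-|_].
    by rewrite (negPf naw) muln0.
  by rewrite mul1n; case: (_ != _); rewrite ?mul1n.
Qed.

Lemma connect_retract u v :
  connect (@adj G) u v -> connect (@adj H) (s u) (s v).
Proof.
case/connectP=> p pp ->.
have [|q [/andP[pq /eqP <-] _ _]] := @walk_retract u (last u p) p.
  by rewrite /is_walk pp eqxx.
by apply/connectP; exists q.
Qed.

Definition to_core u : seq G := if u \in attached then [:: f (s u)] else [::].

Definition extend_walk u v (q : seq H) : seq G :=
  to_core u ++ map f q ++
  (if v \in attached then [:: v] else [::]).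

Lemma extend_walkP u v q :
  is_walk (s u) (s v) q -> is_walk u v (extend_walk u v q).
Proof.
move=> /walk_map/andP[pq /eqP lq]; rewrite /is_walk /extend_walk.
have -> r : path (@adj G) u (to_core u ++ r) = path (@adj G) (f (s u)) r.
  rewrite /to_core; case: ifP => [au|/negbT/not_attached ->] //=.
  by rewrite attached_adj // eqxx.
have -> r : last u (to_core u ++ r) = last (f (s u)) r.
  by rewrite /to_core; case: ifP => [au|/negbT/not_attached ->].
rewrite cat_path last_cat lq pq; case: ifP => [av|/negbT/not_attached ->] //=.
by rewrite adj_sym attached_adj // !eqxx.
Qed.

Lemma geodesic_extend u v q :
  u != v -> geodesic (s u) (s v) q -> geodesic u v (extend_walk u v q).
Proof.
move=> uv [wq minq]; split=> [|p /walk_retract[q' [/minq leq _]]].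
  exact: extend_walkP.
rewrite uv mul1n; apply: leq_trans; rewrite /extend_walk !size_cat size_map.
rewrite addnCA; apply: leq_add => //.
by apply: leq_add; rewrite ?/to_core; case: ifP.
Qed.

Lemma walk_edges_extend u v q (E : {set H}) :
  is_walk (s u) (s v) q ->
  f @: E \in walk_edges u (extend_walk u v q) -> E \in walk_edges (s u) q.
Proof.
move=> /walk_map/andP[_ /eqP lq].
have imN (w : G) : w \in attached -> w \notin f @: E.
  by move=> aw; apply/imsetP=> -[x _ wE]; rewrite wE f_attached in aw.
have head r : f @: E \in walk_edges u (to_core u ++ r) ->
    f @: E \in walk_edges (f (s u)) r.
  rewrite /to_core; case: ifP => [au|/negbT/not_attached ->] //=.
  rewrite walk_edges_cons inE => /orP[/eqP eqE|//].
  by have := imN _ au; rewrite eqE !inE eqxx.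
move=> /head; rewrite walk_edges_cat mem_cat lq walk_edges_map.
rewrite (mem_map (imset_inj f_inj)) => /orP[//|].
case: ifP => [av|//]; rewrite walk_edges_cons inE => /eqP eqE.
by have := imN _ av; rewrite eqE !inE eqxx orbT.
Qed.

Lemma meg_conn_retract : meg_conn H <= meg_conn G.
Proof.
have [M /meg_setP megM <-] := meg_conn_attained G.
apply: leq_trans (leq_imset_card s M); apply: meg_conn_le.
apply/meg_setP => x y; rewrite -f_adj => /megM[u Mu [v Mv mon]].
exists (s u); first exact: imset_f.
exists (s v); first exact: imset_f.
have uv : u != v by apply: contraTneq mon => ->; apply: monitored_irr.
apply/monitoredP => q gq.
apply: (@walk_edges_extend u v); first by case: gq.
rewrite imsetU !imset_set1.
exact/(monitoredP _ _ _ mon)/geodesic_extend.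
Qed.

Lemma monitored_embed x y u v :
  monitored [set x; y] u v -> monitored [set f x; f y] (f u) (f v).
Proof.
move=> /monitoredP mon; apply/monitoredP => p [wp minp].
have [q [wq subq szq]] := walk_retract wp; rewrite !fK in wq subq.
have gq : geodesic u v q.
  split=> // q' /walk_map/minp; rewrite size_map; apply: leq_trans.
  by apply: leq_trans szq; apply: leq_addr.
apply/subq/mapP; exists [set x; y]; first exact: mon.
by rewrite imsetU !imset_set1.
Qed.

Lemma monitored_attached v y :
  v \in attached -> v != y -> monitored [set v; f (s v)] v y.
Proof.
move=> av vy; apply/monitoredP => -[|w p] [/andP[/=]].
  by move=> _; rewrite (negPf vy).
by rewrite attached_adj // walk_edges_cons inE => /andP[/eqP-> _]; rewrite eqxx.
Qed.

Lemma meg_conn_extend :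
    (forall v, v \in attached -> exists2 w, w != v & adj (f (s v)) w) ->
  meg_conn G <= meg_conn H + #|attached|.
Proof.
move=> other; have [M /meg_setP megM <-] := meg_conn_attained H.
rewrite -(card_imset (mem M) f_inj).
apply: leq_trans (leq_card_setU _ _); apply: meg_conn_le.
set N := _ :|: _.
have attN v : v \in attached ->
    exists2 y, y \in N & monitored [set v; f (s v)] v y.
  move=> av; suff [y Ny yv] : exists2 y, y \in N & v != y.
    by exists y => //; apply: monitored_attached.
  have [w wv sw] := other v av.
  have [aw|naw] := boolP (w \in attached).
    by exists w; rewrite 1?eq_sym // inE aw orbT.
  have /megM[m Mm _] : adj (s v) (s w) by rewrite -f_adj (not_attached naw).
  exists (f m); first by rewrite inE imset_f.
  by apply: contraTneq av => ->; rewrite f_attached.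
apply/meg_setP => x y xy.
have [ax|nax] := boolP (x \in attached).
  exists x; first by rewrite inE ax orbT.
  by move: xy; rewrite attached_adj // => /eqP ->; apply: attN.
have [ay|nay] := boolP (y \in attached).
  exists y; first by rewrite inE ay orbT.
  by move: xy; rewrite adj_sym attached_adj // setUC => /eqP ->; apply: attN.
have fx := not_attached nax; have fy := not_attached nay.
have /megM[u Mu [v Mv mon]] : adj (s x) (s y) by rewrite -f_adj fx fy.
exists (f u); first by rewrite inE imset_f.
exists (f v); first by rewrite inE imset_f.
by rewrite -fx -fy; apply: monitored_embed.
Qed.

End PendantExtension.

Lemma meg_conn_induced_full (G : sgraph) (C : {set G}) :
  (forall x, x \in C) -> meg_conn (induced C) = meg_conn G.
Proof.
move=> allC; pose f : induced C -> G := val.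
pose s x : induced C := exist _ x (allC x).
have fK : cancel f s by move=> x; apply: val_inj.
have f_adj : {mono f : x y / adj x y} by [].
have noatt : attached f s = set0 by apply/setP => v; rewrite !inE eqxx.
have att v u : v \in attached f s -> adj v u = (u == f (s v)).
  by rewrite noatt inE.
apply/eqP; rewrite eqn_leq (meg_conn_retract fK f_adj att) -[leqRHS]addn0.
rewrite -(cards0 G) -noatt.
by apply: (meg_conn_extend fK f_adj att) => v; rewrite noatt inE.
Qed.

Lemma meg_edgeless (G : sgraph) : edges G = set0 -> meg G = 0.
Proof.
move=> noE; rewrite /meg; case: ifP => _; first exact: meg_conn_edgeless.
apply: big1 => C _; apply/meg_conn_edgeless/setP => E; rewrite in_set0.
apply/negP => /edgesP[x [y xy _]].
by have := @mem_edges G (val x) (val y) xy; rewrite noE in_set0.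
Qed.

Lemma meg_ge2 (G : sgraph) (x y : G) : adj x y -> 2 <= meg G.
Proof.
move=> xy; rewrite /meg; case: ifP => _; first exact: meg_conn_ge2 xy.
pose C := [set z in [set: G] | connect (@adj G) x z].
have Cx : x \in C by rewrite !inE connect0.
have Cy : y \in C by rewrite !inE connect1.
rewrite (bigD1 C) /=; last by apply: imset_f; rewrite inE.
apply: leq_trans (leq_addr _ _).
exact: (@meg_conn_ge2 _ (exist _ x Cx : induced C) (exist _ y Cy)).
Qed.

Lemma meg_nontrivial_component (G : sgraph) (C : {set G}) :
    C != set0 -> {in C &, forall x y, connect (@adj G) x y} ->
    (forall x y, adj x y -> x \in C) ->
  meg G = meg_conn (induced C).
Proof.
case/set0Pn=> c Cc connC adjC.
have closedC x y : x \in C -> connect (@adj G) x y -> y \in C.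
  move=> Cx xy; rewrite -(closed_connect _ xy) // => a b ab.
  by rewrite (adjC _ _ ab); symmetry; apply: (adjC b a); rewrite adj_sym.
rewrite /meg; case: ifP => [/connectedP[_ conn]|_].
  by rewrite meg_conn_induced_full // => x; apply: closedC Cc (conn _ _).
have classC x : x \in C -> [set z in [set: G] | connect (@adj G) x z] = C.
  move=> Cx; apply/setP => y; rewrite !inE; apply/idP/idP; first exact: closedC.
  exact: connC.
rewrite (bigD1 C) /=; last first.
  by rewrite -(classC c Cc); apply: imset_f; rewrite inE.
rewrite big1 ?addn0 // => B /andP[/imsetP[b _ ->] neqBC].
apply/meg_conn_edgeless/setP => E; rewrite in_set0.
apply/negP => /edgesP[[x Bx] [y /adjC/= Cx _]]; case/eqP: neqBC.
apply: classC; apply: closedC Cx _.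
by move: Bx; rewrite !inE connect_adjC.
Qed.

Section RemovePendant.
Variables (G : sgraph) (F : {set {set G}}).
Hypothesis connG : connected G.
Hypothesis F_pendant : F \subset pendant_edges G.

Definition leaves : {set G} := [set x in cover F | degree x == 1].

Definition stem (x : G) : G :=
  if x \in leaves then odflt x [pick y | adj x y] else x.

Lemma leaf_adj x y : x \in leaves -> adj x y = (y == stem x).
Proof.
move=> Lx; rewrite /stem Lx; move: Lx; rewrite inE => /andP[_ /cards1P[z zE]].
have adjE t : adj x t = (t == z) by move/setP/(_ t): zE; rewrite !inE.
case: pickP => [t|/(_ z)]; rewrite adjE ?eqxx //= => /eqP ->.
by rewrite adjE.
Qed.

Lemma exactly_one_leaf E x y : E \in F -> adj x y -> E = [set x; y] ->
  (x \in leaves) (+) (y \in leaves).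
Proof.
move=> FE xy eqE; move/subsetP/(_ _ FE): (F_pendant).
rewrite inE => /andP[_]; rewrite !inE.
have -> : x \in cover F by apply/bigcupP; exists E; rewrite // eqE !inE eqxx.
have -> : y \in cover F.
  by apply/bigcupP; exists E; rewrite // eqE !inE eqxx orbT.
have xNy : x != y by apply: contraTneq xy => ->; rewrite adj_irr.
have -> : [set z in E | degree z == 1] =
    (if degree x == 1 then [set x] else set0) :|:
    (if degree y == 1 then [set y] else set0).
  apply/setP => z; rewrite eqE !inE.
  have [->|zNx] := eqVneq z x.
    by do 2!case: ifP => _; rewrite !inE ?eqxx ?(negPf xNy).
  have [->|zNy] := eqVneq z y.
    by do 2!case: ifP => _; rewrite !inE ?eqxx ?[y == x]eq_sym ?(negPf xNy).
  by do 2!case: ifP => _; rewrite !inE ?(negPf zNx) ?(negPf zNy).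
by do 2!case: ifP; rewrite ?setU0 ?set0U ?cards2 ?cards1 ?cards0 ?xNy //=.
Qed.

Lemma removed_edgeP E :
  E \in F -> exists x, exists2 y, adj x y & E = [set x; y].
Proof.
move=> FE; move/subsetP/(_ _ FE): (F_pendant).
by rewrite inE => /andP[/andP[/edgesP]].
Qed.

Lemma leaf_edge x : x \in leaves -> [set x; stem x] \in F.
Proof.
move=> Lx; have := Lx; rewrite inE => /andP[/bigcupP[E FE Ex] _].
have [a [b ab eqE]] := removed_edgeP FE.
move: Ex FE; rewrite eqE !inE => /orP[] /eqP eqx.
  by move: ab; rewrite -eqx leaf_adj // => /eqP ->.
by move: ab; rewrite -eqx adj_sym leaf_adj // setUC => /eqP ->.
Qed.

Lemma leaf_stem x : x \in leaves -> stem x \notin leaves.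
Proof.
move=> Lx; have xs : adj x (stem x) by rewrite leaf_adj.
by have := exactly_one_leaf (leaf_edge Lx) xs erefl; rewrite Lx => /negbTE ->.
Qed.

Lemma stem_notin_leaves x : stem x \in ~: leaves.
Proof.
rewrite inE; have [Lx|nLx] := boolP (x \in leaves); first exact: leaf_stem.
by rewrite /stem (negPf nLx).
Qed.

Lemma card_leaves : #|leaves| <= #|F|.
Proof.
rewrite -(@card_in_imset _ _ (fun x => [set x; stem x])) => [|x y Lx Ly eqxy].
  by apply/subset_leq_card/subsetP => _ /imsetP[x /leaf_edge FE ->].
have : y \in [set x; stem x] by rewrite eqxy !inE eqxx.
rewrite !inE => /orP[/eqP //|/eqP eqy].
by have := leaf_stem Lx; rewrite -eqy Ly.
Qed.

Lemma leaf_isolated (x y : del_edges F) : adj x y -> x \notin leaves.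
Proof.
case/andP=> xy; apply: contra => Lx; move: xy.
by rewrite leaf_adj // => /eqP ->; apply: leaf_edge.
Qed.

Let core : sgraph := @induced (del_edges F) (~: leaves).
Let inj_core : core -> G := val.
Let retract (x : G) : core := exist _ (stem x) (stem_notin_leaves x).

Lemma inj_coreK : cancel inj_core retract.
Proof.
move=> x; apply: val_inj; apply: ifN.
by have := valP x; rewrite inE.
Qed.

Lemma inj_core_adj : {mono inj_core : x y / adj x y}.
Proof.
move=> x y.
have nleaf z : inj_core z \notin leaves by have := valP z; rewrite inE.
have -> : adj x y =
    adj (inj_core x) (inj_core y) && ([set inj_core x; inj_core y] \notin F).
  by [].
case: (boolP (adj _ _)) => //= xy.
apply/esym/negP => /exactly_one_leaf/(_ xy erefl).
by rewrite !(negPf (nleaf _)).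
Qed.

Lemma attached_core : attached inj_core retract = leaves.
Proof.
apply/setP => x; rewrite inE -[inj_core _]/(stem x).
have [Lx|nLx] := boolP (x \in leaves); last by rewrite /stem (negPf nLx) eqxx.
by apply: contraTneq (Lx) => eqx; rewrite -eqx leaf_stem.
Qed.

Lemma attached_core_adj v u :
  v \in attached inj_core retract -> adj v u = (u == inj_core (retract v)).
Proof. by rewrite attached_core => /leaf_adj ->. Qed.

Lemma meg_del_edges : meg (del_edges F) = meg_conn core.
Proof.
have [[x _] conn] := connectedP _ connG.
apply: meg_nontrivial_component => [|a b Ca Cb|a b /leaf_isolated].
- by apply/set0Pn; exists (stem x); apply: stem_notin_leaves.
- have := connect_retract inj_coreK inj_core_adj attached_core_adj (conn a b).
  rewrite -[a]/(inj_core (exist _ a Ca)) -[b]/(inj_core (exist _ b Cb)).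
  rewrite !inj_coreK; case/connectP=> p pp bE.
  apply/connectP; exists (map val p); first by rewrite path_map.
  by rewrite last_map -bE.
- by rewrite in_setC.
Qed.

Lemma meg_del_edges_bounds :
  meg G - #|F| <= meg (del_edges F) <= meg G.
Proof.
rewrite meg_del_edges /meg connG leq_subLR addnC.
rewrite (meg_conn_retract inj_coreK inj_core_adj attached_core_adj) andbT.
apply: leq_trans (leq_add (leqnn _) card_leaves).
rewrite -attached_core; apply: meg_conn_extend.
- exact: inj_coreK.
- exact: inj_core_adj.
- exact: attached_core_adj.
rewrite attached_core => v Lv.
have xs : adj v (stem v) by rewrite leaf_adj.
have : degree (stem v) != 1.
  have := leaf_stem Lv; rewrite inE.
  suff -> : stem v \in cover F by [].
  apply/bigcupP; exists [set v; stem v]; rewrite ?leaf_edge //.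
  by rewrite !inE eqxx orbT.
rewrite /degree => deg.
have /card_gt1P[a [b []]] : 1 < #|[set y | adj (stem v) y]|.
  rewrite ltn_neqAle eq_sym deg; apply/card_gt0P; exists v.
  by rewrite inE adj_sym.
rewrite !inE => sa sb ab; have [eqa|nav] := eqVneq a v; last by exists a.
by exists b => //; rewrite -eqa eq_sym.
Qed.

End RemovePendant.

Lemma pendant_leaf (G : sgraph) (x y : G) :
    connected G -> adj x y -> degree x = 1 -> degree y != 1 ->
  [set x; y] \in pendant_edges G.
Proof.
move=> /connectedP[_ conn] xy dx dy.
have xNy : x != y by apply: contraTneq xy => ->; rewrite adj_irr.
rewrite inE /cut_edge mem_edges //=; apply/andP; split; last first.
  apply/cards1P; exists x; apply/setP => z; rewrite !inE.
  have [->|_] /= := eqVneq z x; first by rewrite dx.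
  by have [->|] := eqVneq z y; first exact: negPf.
have G1 : ncomp G = 1 by apply/eqP/connectedP; split=> //; exists x.
rewrite G1 ltn_neqAle eq_sym; apply/andP; split; last first.
  apply/card_gt0P; exists (root (@del_adj G [set [set x; y]]) x).
  rewrite inE /= andbT; apply: roots_root.
  exact: (@connect_adjC (del_edges [set [set x; y]])).
apply/negP => /connectedP[_ /(_ x y)/connectP[[|z p] /=]].
  by move=> _ eqxy; rewrite eqxy eqxx in xNy.
case/andP=> /andP[xz]; rewrite inE => /negP[].
have /cards1P[w wE] : degree x == 1 by rewrite dx.
move/setP: wE => wE; have := wE y; have := wE z; rewrite !inE xz xy.
by move=> /esym/eqP -> /esym/eqP ->.
Qed.

Definition star_adj : rel (option bool) := [rel x y | isSome x (+) isSome y].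

Lemma star_adj_sym : symmetric star_adj.
Proof. by move=> x y; apply: addbC. Qed.

Lemma star_adj_irr : irreflexive star_adj.
Proof. by move=> x; apply: addbb. Qed.

Definition star : sgraph := SGraph star_adj_sym star_adj_irr.

Lemma star_connected : connected star.
Proof.
apply/connectedP; split; first by exists None.
have toC (x : star) : connect (@adj star) x None.
  by case: x => [b|]; [apply: connect1 | apply: connect0].
move=> x y; apply: connect_trans (toC x) _.
by rewrite connect_adjC.
Qed.

Definition star_edge (b : bool) : {set star} := [set Some b; None].

Lemma star_edge_pendant b : star_edge b \in pendant_edges star.
Proof.
apply: pendant_leaf => //; first exact: star_connected.
  apply/eqP/cards1P; exists None; apply/setP => x; rewrite !inE.
  by case: x.
rewrite neq_ltn; apply/orP; right; apply/card_gt1P.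
by exists (Some true), (Some false); rewrite !inE.
Qed.

Lemma star_edges : edges star = [set star_edge true; star_edge false].
Proof.
apply/setP => E; rewrite in_set2; apply/idP/orP.
  case/edgesP=> -[b|] [[c|] //= _ ->].
    by case: b; [left | right].
  by rewrite setUC; case: c; [left | right].
by case=> /eqP ->; apply: mem_edges.
Qed.

Lemma edges_del_edges (G : sgraph) (F : {set {set G}}) :
  edges (del_edges F) = edges G :\: F.
Proof.
apply/setP => E; rewrite in_setD; apply/edgesP/andP.
  case=> x [y /andP[xy nF] ->].
  by split=> //; apply: (@mem_edges G x y).
case=> nF EG; have /edgesP[x [y xy EE]] : E \in edges G := EG.
by exists x, y; rewrite // /= /del_adj /= xy -EE.
Qed.

Theorem theorem4p3 :
  (forall (G : sgraph) (k l : nat) (F : {set {set G}}),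
     connected G -> #|pendant_edges G| = k -> l <= k ->
     F \subset pendant_edges G -> #|F| = l ->
     meg G - l <= meg (del_edges F) <= meg G) /\
  (exists (G : sgraph) (l : nat) (F : {set {set G}}),
     [/\ connected G, F \subset pendant_edges G, #|F| = l, 0 < l &
         meg (del_edges F) + l = meg G]) /\
  (exists (G : sgraph) (l : nat) (F : {set {set G}}),
     [/\ connected G, F \subset pendant_edges G, #|F| = l, 0 < l &
         meg (del_edges F) = meg G]).
Proof.
have subF : edges star \subset pendant_edges star.
  rewrite star_edges; apply/subsetP => E; rewrite in_set2.
  by case/orP=> /eqP ->; apply: star_edge_pendant.
have meg_star_ge2 : 2 <= meg star by apply: (@meg_ge2 star None (Some true)).
have meg_del : meg (del_edges (edges star)) = 0.
  by apply: meg_edgeless; rewrite edges_del_edges setDv.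
have card_edges : #|edges star| <= 2 by rewrite star_edges cards2 ltnS leq_b1.
have meg_star_le : meg star <= #|edges star|.
  have /andP[] := meg_del_edges_bounds star_connected subF.
  by rewrite meg_del leqn0 subn_eq0.
split; [|split].
- by move=> G k l F connG _ _ subFG <-; apply: meg_del_edges_bounds.
- exists star, #|edges star|, (edges star).
  split; [exact: star_connected | exact: subF | by [] | |].
  + exact: leq_trans (leq_trans meg_star_ge2 meg_star_le).
  + apply/eqP; rewrite meg_del eqn_leq meg_star_le andbT.
    exact: leq_trans card_edges meg_star_ge2.
- exists star, 1, [set star_edge true].
  have sub1 : [set star_edge true] \subset pendant_edges star.
    by rewrite sub1set star_edge_pendant.
  split; [exact: star_connected | exact: sub1 | exact: cards1 | by [] |].
  apply/eqP; rewrite eqn_leq; apply/andP; split.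
    by have /andP[_ le_meg] := meg_del_edges_bounds star_connected sub1.
  apply: leq_trans (leq_trans meg_star_le card_edges) _.
  apply: (@meg_ge2 (del_edges [set star_edge true]) (Some false) None).
  rewrite /= /del_adj /= inE; apply/negP => /eqP/setP/(_ (Some true)).
  by rewrite !inE.
Qed.
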